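(* Let $G$ be a finite group, $k\ge 1$, and $\emptyset\neq A\subset G$. Then \[ \mu_{k-1}(Y_{A,k}) \;\geq\; |A|-k\cdot \nu(A). \]
   Context: Let $G$ be a finite group of order $n$ and $k\ge1$. For $1\le i\le k+1$ let $V_i=\{i\}\times G$, viewed as a $0$-dimensional complex. $Y_{G,k}$ denotes the simplicial join $V_1*\cdots*V_{k+1}$, i.e. the simplicial complex on vertex set $V_1\cup\cdots\cup V_{k+1}$ whose simplices are the sets containing at most one vertex from each $V_i$. For $A\subset G$, $Y_{A,k}$ is the subcomplex of $Y_{G,k}$ containing the full $(k-1)$-skeleton of $Y_{G,k}$ and whose $k$-simplices are the sets $\{(1,x_1),\ldots,(k+1,x_{k+1})\}$ with $x_1x_2\cdots x_{k+1}\in A$. For a simplicial complex $X$ and $j\ge0$, $C^j(X)$ is the real vector space of real-valued skew-symmetric functions on ordered $j$-simplices, $C^{-1}(X)=\mathbb R$; the coboundary $d_j:C^j\to C^{j+1}$ is $d_j\phi([v_0,\dots,v_{j+1}])=\sum_i(-1)^i\phi([v_0,\dots,\widehat{v_i},\dots,v_{j+1}])$, and $d_{-1}(a)(v)=a$. Each $C^j(X)$ has the standard inner product $(\phi,\psi)_X=\sum_{\sigma\in X(j)}\phi(\sigma)\psi(\sigma)$ (one fixed orientation per simplex), and $d_j^*$ denotes the adjoint. The reduced $j$-th Laplacian is $L_j(X)=d_{j-1}d_{j-1}^*+d_j^*d_j$ on $C^j(X)$, and $\mu_j(X)$ denotes its minimal eigenvalue (the $j$-th spectral gap). Let $\widehat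 G_+$ be the set of (isomorphism classes of) nontrivial irreducible unitary complex representations $\rho:G\to U(d_\rho)$. For $\rho$ let $\widehat{1_A}(\rho)=\sum_{a\in A}\rho(a)\in M_{d_\rho}(\mathbb C)$, and let $\nu(A)=\max_{\rho\in\widehat G_+}\|\widehat{1_A}(\rho)\|$, where $\|\cdot\|$ is the spectral (operator) norm. *)

(* Defs.v *)
From HB Require Import structures.
From mathcomp Require Import all_boot all_order all_algebra all_fingroup.
From mathcomp Require Import mxrepresentation.
From mathcomp Require Import complex.

Set Implicit Arguments.
Unset Strict Implicit.
Unset Printing Implicit Defensive.

Import Order.TTheory GRing.Theory Num.Theory.
Local Open Scope ring_scope.

(*  The join Y_{G,k} = V_1 * ... * V_{k+1}, V_i = {i} x G.                   *)
(*  A simplex of Y_{G,k} (at most one vertex in each V_i) is encoded by     *)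
(*  s : {ffun 'I_(k+1) -> option gT}, the simplex being                     *)
(*  {(i, x) | s i = Some x}.  The empty simplex (all None) is the unique    *)
(*  (-1)-simplex, so C^{-1} = R is the space of functions on it.            *)
(*  A j-simplex has #|supp s| = j+1 vertices.                               *)
(*  Each simplex is given its canonical orientation: vertices listed by     *)
(*  increasing index i; a skew-symmetric cochain is identified with its     *)
(*  values on canonically oriented simplices.                               *)

Section Complex.
Variables (gT : finGroupType) (n : nat).

Definition simplex := {ffun 'I_n -> option gT}.

Definition supp (s : simplex) : {set 'I_n} := [set i | s i != None].

Definition pos (s : simplex) (i : 'I_n) : nat :=
  #|[set i' in supp s | (i' < i)%N]|.

Definition rem_vertex (s : simplex) (i : 'I_n) : simplex :=
  [ffun i' => if i' == i then None else s i'].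

Definition add_vertex (s : simplex) (i : 'I_n) (x : gT) : simplex :=
  [ffun i' => if i' == i then Some x else s i'].

Definition sgn (R : pzRingType) (t : nat) : R := (-1) ^+ t.

Variable R : pzRingType.

(* coboundary: (d phi)[v_0,...,v_{j+1}] = sum_t (-1)^t phi[.. ^v_t ..] ;
   for the vertices (i.e. j = -1) this is d_{-1}(a)(v) = a. *)
Definition cobd (phi : simplex -> R) (s : simplex) : R :=
  \sum_(i in supp s) sgn R (pos s i) * phi (rem_vertex s i).

(* adjoint of the coboundary w.r.t. the standard inner products of the
   subcomplex Y (given by its set of simplices, closed under faces):
   (d^* psi)(t) = sum over the simplices s of Y having t as a codim-1 face
   of [s : t] psi(s). *)
Definition cobd_adj (Y : pred simplex) (psi : simplex -> R) (t : simplex) : R :=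
  \sum_(i | i \notin supp t) \sum_(x : gT)
     (if Y (add_vertex t i x) then sgn R (pos t i) * psi (add_vertex t i x)
      else 0).

Definition laplacian (Y : pred simplex) (phi : simplex -> R) (t : simplex) : R :=
  cobd (cobd_adj Y phi) t + cobd_adj Y (cobd phi) t.

(* the j-simplices of Y, indexed by their number of vertices m = j+1 *)
Definition faces_of (Y : pred simplex) (m : nat) : pred simplex :=
  [pred s | Y s && (#|supp s| == m)].

Definition lap_eigenvalue (Y : pred simplex) (m : nat) (lam : R) : Prop :=
  exists phi : simplex -> R,
    (exists t, faces_of Y m t /\ phi t != 0) /\
    (forall t, faces_of Y m t -> laplacian Y phi t = lam * phi t).

End Complex.

Definition is_spectral_gap (R : numDomainType) (gT : finGroupType) (n : nat)
  (Y : pred (simplex gT n)) (m : nat) (mu : R) : Prop :=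
  lap_eigenvalue Y m mu /\ (forall lam, lap_eigenvalue Y m lam -> mu <= lam).

Definition Y_A (gT : finGroupType) (k : nat) (A : {set gT}) : pred (simplex gT k.+1) :=
  [pred s | (#|supp s| <= k)%N ||
            ((#|supp s| == k.+1) && ((\prod_(i < k.+1) odflt 1%g (s i))%g \in A))].

Section Fourier.
Variable R : rcfType.
Local Open Scope complex_scope.

Definition adjmx (d : nat) (M : 'M[R[i]]_d) : 'M[R[i]]_d :=
  (map_mx (@conjc R) M)^T.

Definition sqmod (z : R[i]) : R := let: a +i* b := z in (a ^+ 2 + b ^+ 2)%R.

Definition vnorm (d : nat) (v : 'cV[R[i]]_d) : R :=
  Num.sqrt (\sum_(j < d) sqmod (v j 0)).

Definition opnorm_le (d : nat) (M : 'M[R[i]]_d) (b : R) : Prop :=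
  forall v : 'cV[R[i]]_d, (vnorm (M *m v) <= b * vnorm v)%R.

Variable gT : finGroupType.

Definition unitary_repr (d : nat) (rG : mx_representation R[i] [set: gT]%G d) :=
  forall g, rG g *m adjmx (rG g) = 1%:M.

Definition nontriv_irr_unitary (d : nat)
  (rG : mx_representation R[i] [set: gT]%G d) : Prop :=
  [/\ mx_irreducible rG, unitary_repr rG & exists g, rG g != 1%:M].

Definition fourier_ind (d : nat) (rG : mx_representation R[i] [set: gT]%G d)
  (A : {set gT}) : 'M[R[i]]_d := \sum_(a in A) rG a.

(* nu is nu(A) = max over nontrivial irreducible unitary rho of
   ||\hat{1_A}(rho)||  (with the convention nu(A) = 0 if G is trivial):
   nu is the least nonnegative upper bound of these spectral norms. *)
Definition is_nu (A : {set gT}) (nu : R) : Prop :=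
  [/\ (0 <= nu)%R,
      (forall d (rG : mx_representation R[i] [set: gT]%G d),
          nontriv_irr_unitary rG -> opnorm_le (fourier_ind rG A) nu) &
      (forall b : R, (0 <= b)%R ->
         (forall d (rG : mx_representation R[i] [set: gT]%G d),
             nontriv_irr_unitary rG -> opnorm_le (fourier_ind rG A) b) ->
         (nu <= b)%R)].

End Fourier.

(* Main.v *)
(** Write [phi_i] for the restriction of a (k-1)-cochain [phi] to the facets missing the [i]-th
    vertex, seen as a function on G^(k+1) that does not depend on the [i]-th coordinate.  In the
    energy [(L phi, phi)] the diagonal terms of [d^* d] contribute exactly [#|A| * |phi|^2], and the
    off-diagonal terms are forms [\sum_(y, z) 1_A(a y b z c) g(y) f(z)] on two-dimensional slices
    of G^(k+1).  Up to a change of variables such a form is convolution by [1_A].  On functions of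
    mean zero, convolution has norm at most [nu], since the regular representation splits
    orthogonally into irreducible unitary ones.  The part coming from the means is absorbed by the
    down-Laplacian [d d^*], because [#|A| <= #|G|].  Hence each pair [i != j] costs at most
    [nu * (|phi_i|^2 + |phi_j|^2)], and the total cost is [k * nu * |phi|^2]. *)
Require Import Defs.
From HB Require Import structures.
From mathcomp Require Import all_boot all_order all_algebra all_fingroup.
From mathcomp Require Import mxrepresentation complex spectral sesquilinear.
From mathcomp Require Import ring lra.
Import Order.TTheory GRing.Theory Num.Theory.
Local Open Scope ring_scope.
Set Implicit Arguments.
Unset Strict Implicit.
Unset Printing Implicit Defensive.

(** * Unitary representations and the norm of [fourier_ind rG A] *)

Section UnitaryRepresentations.
Local Open Scope sesquilinear_scope.
Variable R : rcfType.
Local Notation C := (R[i]).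

Definition sqnorm d (v : 'cV[C]_d) : R := \sum_(j < d) sqmod (v j 0).

Lemma sqnorm_ge0 d (v : 'cV[C]_d) : 0 <= sqnorm v.
Proof.
apply: sumr_ge0 => j _; case: (v j 0) => a b /=.
by rewrite addr_ge0 ?sqr_ge0.
Qed.

Lemma vnorm_sqr d (v : 'cV[C]_d) : vnorm v ^+ 2 = sqnorm v.
Proof. by rewrite /vnorm sqr_sqrtr // sqnorm_ge0. Qed.

Lemma sqnormE d (v : 'cV[C]_d) : (sqnorm v)%:C%C = (v^t* *m v) 0 0.
Proof.
rewrite mxE rmorph_sum; apply: eq_bigr => j _; rewrite !mxE mulrC.
case: (v j 0) => a b; apply/eqP; rewrite eq_complex /=; apply/andP.
by split; apply/eqP; ring.
Qed.

Lemma opnorm_le_sqnorm d (M : 'M[C]_d) (b : R) (v : 'cV[C]_d) :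
  opnorm_le M b -> sqnorm (M *m v) <= b ^+ 2 * sqnorm v.
Proof.
move=> /(_ v) Mb; rewrite -!vnorm_sqr -exprMn.
by rewrite lerXn2r ?nnegrE ?sqrtr_ge0 // (le_trans _ Mb) ?sqrtr_ge0.
Qed.

Lemma adj_mxE m n (M : 'M[C]_(m, n)) i j : (M^t*) i j = (M j i)^*.
Proof. by rewrite !mxE. Qed.

Lemma adj_mul m n p (M : 'M[C]_(m, n)) (N : 'M[C]_(n, p)) :
  (M *m N)^t* = N^t* *m M^t*.
Proof. by rewrite trmx_mul map_mxM. Qed.

Lemma adjmxE d (M : 'M[C]_d) : adjmx M = M^t*.
Proof. by rewrite /adjmx map_trmx. Qed.

(** [P] and [Q] come from Gram-Schmidt on [V] and on its orthogonal complement. Stacked, they form a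
    unitary matrix [U]: the orthogonality relations are blocks of [U *m U^t* = 1], the last one is
    [U^t* *m U = 1]. *)
Lemma orthonormal_split d (V : 'M[C]_d) :
  exists r, exists (P : 'M[C]_(\rank V, d)) (Q : 'M[C]_(r, d)),
  [/\ (\rank V + r = d)%N, (P :=: V)%MS,
      [/\ P *m P^t* = 1%:M, Q *m Q^t* = 1%:M & P *m Q^t* = 0] &
      P^t* *m P + Q^t* *m Q = 1%:M].
Proof.
set W := orthomx Num.Def.conjC (mx_of_hermitian (hermitian1mx d)) V.
have rW : (\rank V + \rank W)%N = d by rewrite add_rank_ortho.
have := schmidt_complete_unitarymx V; rewrite /schmidt_complete -/W.
set P := schmidt _; set Q := schmidt _ => U.
exists (\rank W), P, Q; split=> //.
- by apply: eqmx_trans (eq_row_base V); apply: eqmx_schmidt_free; apply: row_base_free.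
- move/unitarymxP: (U); rewrite tr_col_mx map_row_mx mul_col_row.
  by rewrite scalar_mx_block => /eq_block_mx[].
- have := mulmxKtV 1%:M U rW; rewrite mul1mx tr_col_mx map_row_mx.
  by rewrite mul_row_col.
Qed.

Lemma sqnorm_split r s d (P : 'M[C]_(r, d)) (Q : 'M[C]_(s, d)) (v : 'cV[C]_d) :
  P^t* *m P + Q^t* *m Q = 1%:M ->
  sqnorm v = sqnorm (P *m v) + sqnorm (Q *m v).
Proof.
move=> PQ; apply: complexI; rewrite rmorphD /= !sqnormE.
have -> : v^t* *m v = v^t* *m (P^t* *m P + Q^t* *m Q) *m v by rewrite PQ mulmx1.
by rewrite !adj_mul mulmxDr mulmxDl mxE !mulmxA.
Qed.

Variables (gT : finGroupType) (A : {set gT}) (nu : R).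

Section Compression.
Variables (d r : nat) (rG : mx_representation C [set: gT]%G d).
Variable Q : 'M[C]_(r, d).
Hypothesis Qiso : Q *m Q^t* = 1%:M.
Hypothesis Qinv : forall g, Q *m rG g *m Q^t* *m Q = Q *m rG g.

(** [Q^t* *m Q] projects onto the row space of [Q], so [Qinv] says that this space is invariant; the
    matrix is the action of [g] on it in the orthonormal basis of the rows of [Q]. *)
Definition compress_mx (g : gT) : 'M[C]_r := Q *m rG g *m Q^t*.

Lemma compress_mx_repr : mx_repr [set: gT] compress_mx.
Proof.
split=> [|x y _ _]; first by rewrite /compress_mx repr_mx1 mulmx1.
by rewrite /compress_mx repr_mxM ?inE // !mulmxA Qinv.
Qed.
Canonical compress_repr := MxRepresentation compress_mx_repr.

Lemma compress_unitary : unitary_repr rG -> unitary_repr compress_repr.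
Proof.
move=> U g; have := U g; rewrite !adjmxE /= /compress_mx => Ug.
rewrite !adj_mul trmxCK !mulmxA Qinv.
by rewrite -[Q *m rG g *m _]mulmxA Ug mulmx1.
Qed.

Lemma compress_fourier (v : 'cV[C]_d) :
  fourier_ind compress_repr A *m (Q *m v) = Q *m (fourier_ind rG A *m v).
Proof.
rewrite !mulmxA; congr (_ *m v); rewrite /fourier_ind mulmx_suml mulmx_sumr.
by apply: eq_bigr => a _; rewrite /= /compress_mx Qinv.
Qed.

(** If [w] is fixed by the compression, then [w *m Q] is fixed by [rG]. *)
Lemma compress_fixed (v : 'cV[C]_d) :
  (forall w : 'rV_d, (forall g, w *m rG g = w) -> w *m v = 0) ->
  (forall w : 'rV_r, (forall g, w *m compress_repr g = w) -> w *m (Q *m v) = 0).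
Proof.
move=> Hv w Hw; rewrite mulmxA; apply: Hv => g.
by rewrite -mulmxA -Qinv -[in RHS](Hw g) /= /compress_mx !mulmxA.
Qed.

End Compression.

Hypothesis nu_ge0 : 0 <= nu.
Hypothesis nu_bound : forall d (rG : mx_representation C [set: gT]%G d),
  nontriv_irr_unitary rG -> opnorm_le (fourier_ind rG A) nu.

(* Induction on [d]: a proper invariant subspace and its orthogonal complement carry unitary
   representations of smaller degree, and the square norms of the two parts add up. *)
Lemma fourier_bound d (rG : mx_representation C [set: gT]%G d) (v : 'cV[C]_d) :
  unitary_repr rG ->
  (forall w : 'rV_d, (forall g, w *m rG g = w) -> w *m v = 0) ->
  sqnorm (fourier_ind rG A *m v) <= nu ^+ 2 * sqnorm v.
Proof.
have [m] := ubnP d; elim: m => // m IHm in d rG v * => /ltnSE led U Hv.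
have v0_ok : v = 0 -> sqnorm (fourier_ind rG A *m v) <= nu ^+ 2 * sqnorm v.
  move=> ->; rewrite mulmx0 (_ : sqnorm 0 = 0) ?mulr0 //.
  by apply: complexI; rewrite sqnormE mulmx0 mxE.
have [d0|d_gt0] := posnP d.
  by apply: v0_ok; apply/matrixP => -[i lt_id]; exfalso; rewrite d0 in lt_id.
(* Negating the bound makes irreducibility provable: a proper nonzero submodule would yield the
   bound by induction. Irreducibility then yields the bound directly, a contradiction. *)
rewrite leNgt; apply/negP => big.
suff irr : mx_irreducible rG.
  move: big; rewrite ltNge => /negP; apply.
  have [/forallP triv|] := boolP [forall g, rG g == 1%:M].
    (* Here every row vector is fixed, so [Hv] on the rows of the identity gives [v = 0]. *)
    apply: v0_ok; rewrite -[v]mul1mx; apply/row_matrixP => i.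
    rewrite row_mul row0 Hv // => g.
    by rewrite (eqP (triv g)) mulmx1.
  rewrite negb_forall => /existsP ntriv.
  by apply: opnorm_le_sqnorm; apply: nu_bound.
apply/mx_irrP; split=> // V Vmod Vn0; rewrite -sub1mx; apply: contraTT big.
rewrite sub1mx /row_full => rV; rewrite -leNgt.
have {}rV : (\rank V < d)%N by rewrite ltn_neqAle rV rank_leq_col.
have [r [P [Q [rd PV [PP QQ PQ] PQ1]]]] := orthonormal_split V.
have QP : Q *m P^t* = 0.
  by rewrite -[Q *m _]trmxCK adj_mul trmxCK PQ trmx0 map_mx0.
have rV0 : (0 < \rank V)%N by rewrite lt0n mxrank_eq0.
have rGV g : rG g^-1%g = (rG g)^t*.
  have /mulmx1_unit[Ug _] := U g.
  rewrite repr_mxV ?inE //; apply: (can_inj (mulKmx Ug)).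
  by rewrite mulmxV // -(U g) adjmxE.
have split_id n (X : 'M_(n, d)) : X = X *m P^t* *m P + X *m Q^t* *m Q.
  by rewrite -!mulmxA -mulmxDr PQ1 mulmx1.
have PgQ g : P *m rG g *m Q^t* = 0.
  have : (P *m rG g <= P)%MS.
    by rewrite (eqmxMr _ PV) PV; apply: (mxmoduleP Vmod); rewrite inE.
  by case/submxP => D ->; rewrite -mulmxA PQ mulmx0.
(* By unitarity this is the adjoint of [PgQ] at [g^-1]: the orthogonal complement of [V] is
   invariant too. *)
have QgP g : Q *m rG g *m P^t* = 0.
  have -> : Q *m rG g *m P^t* = (P *m rG g^-1%g *m Q^t*)^t*.
    by rewrite !adj_mul rGV !trmxCK mulmxA.
  by rewrite PgQ trmx0 map_mx0.
have Pinv g : P *m rG g *m P^t* *m P = P *m rG g.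
  by rewrite [RHS]split_id PgQ mul0mx addr0.
have Qinv g : Q *m rG g *m Q^t* *m Q = Q *m rG g.
  by rewrite [RHS]split_id QgP mul0mx add0r.
rewrite (sqnorm_split _ PQ1) (sqnorm_split v PQ1) mulrDr.
rewrite -(compress_fourier PP Pinv) -(compress_fourier QQ Qinv).
have rlt : (r < d)%N by rewrite -[X in (_ < X)%N]rd -[X in (X < _)%N]add0n ltn_add2r.
apply: lerD.
- apply: (IHm _ (compress_repr PP Pinv)); first exact: leq_trans led.
    exact: compress_unitary.
  exact: compress_fixed.
- apply: (IHm _ (compress_repr QQ Qinv)); first exact: leq_trans led.
    exact: compress_unitary.
  exact: compress_fixed.
Qed.

(** * The regular representation and convolution by the indicator of [A] *)

Local Notation regular := (regular_repr C [set: gT]%G).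

Lemma regularE g i j :
  regular g i j = (j == gring_index [set: gT]%G (enum_val i * g)%g)%:R.
Proof. by rewrite !mxE eqxx. Qed.

Lemma regular_unitary : unitary_repr regular.
Proof.
move=> g; rewrite adjmxE; apply/matrixP => i j; rewrite [LHS]mxE [RHS]mxE.
rewrite (bigD1 (gring_index [set: gT]%G (enum_val i * g)%g)) //= big1 => [|l nl].
  rewrite addr0 adj_mxE !regularE eqxx mul1r rmorph_nat.
  rewrite (can_in_eq (@gring_indexK _ [set: gT]%G)) ?inE //.
  by rewrite (inj_eq (mulIg g)) (inj_eq enum_val_inj).
by rewrite regularE (negPf nl) mul0r.
Qed.

Lemma regular_mul_col (f : gT -> C) g i :
  (regular g *m (\col_j f (enum_val j))) i 0 = f (enum_val i * g)%g.
Proof.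
rewrite mxE (bigD1 (gring_index [set: gT]%G (enum_val i * g)%g)) //= big1 => [|l nl].
  by rewrite regularE mxE eqxx mul1r addr0 gring_indexK ?inE.
by rewrite regularE (negPf nl) mul0r.
Qed.

(** For [g] the quotient of the elements indexed by [i] and [j], the adjoint of [regular g] moves
    entry [j] to place [i]. *)
Lemma regular_fixed (w : 'rV[C]_(gcard [set: gT]%G)) :
  (forall g, w *m regular g = w) -> forall i j, w 0 i = w 0 j.
Proof.
move=> Hw i j; have {Hw} := Hw ((enum_val i)^-1 * enum_val j)%g.
set g := (_ * _)%g => Hw.
have : w *m (regular g)^t* = w.
  by rewrite -{1}Hw -mulmxA -adjmxE regular_unitary mulmx1.
move/rowP/(_ i) => <-; rewrite mxE (bigD1 j) //= big1 => [|l nl].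
  by rewrite adj_mxE regularE /g mulKVg gring_valK !eqxx rmorph1 mulr1 addr0.
by rewrite adj_mxE regularE /g mulKVg gring_valK (negPf nl) rmorph0 mulr0.
Qed.

(** The inner sum is [fourier_ind regular A] applied to [f]. As fixed row vectors are constant, the
    zero mean of [f] is what [fourier_bound] requires. *)
Lemma convolution_bound (f : gT -> R) : \sum_u f u = 0 ->
  \sum_u (\sum_(s in A) f (u * s)%g) ^+ 2 <= nu ^+ 2 * \sum_u f u ^+ 2.
Proof.
move=> f0; pose v : 'cV[C]_(gcard [set: gT]%G) := \col_j (f (enum_val j))%:C%C.
have sumT (F : gT -> R) : \sum_u F u = \sum_(i < gcard [set: gT]%G) F (enum_val i).
  by rewrite -(big_enum_val F); apply: eq_bigl => u; rewrite inE.
have sqmodr (x : R) : sqmod x%:C%C = x ^+ 2 by rewrite /= expr0n addr0.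
have Mv i : (fourier_ind regular A *m v) i 0 =
    (\sum_(s in A) f (enum_val i * s)%g)%:C%C.
  rewrite /fourier_ind mulmx_suml summxE rmorph_sum; apply: eq_bigr => s _.
  exact: (regular_mul_col (fun u => (f u)%:C%C)).
have := @fourier_bound _ regular v regular_unitary.
rewrite /sqnorm !sumT.
under eq_bigr do rewrite Mv sqmodr.
under [X in _ * X]eq_bigr do rewrite mxE sqmodr.
apply=> w /regular_fixed wconst.
have [i0] : exists i0 : 'I_(gcard [set: gT]%G), true.
  by exists (gring_index [set: gT]%G 1%g).
move=> _; apply/matrixP => i j; rewrite !ord1 !mxE.
under eq_bigr => l _ do rewrite (wconst l i0) mxE.
by rewrite -mulr_sumr -rmorph_sum -sumT f0 rmorph0 mulr0.
Qed.

(** With [h] the convolution of [f], sum [nu * (g u + h u / nu) ^+ 2 >= 0] over [u] and control the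
    squares of [h] by [convolution_bound]. *)
Lemma convolution_form_bound (f g : gT -> R) : \sum_u f u = 0 ->
  - (nu * (\sum_u f u ^+ 2 + \sum_u g u ^+ 2)) <=
  2 * \sum_u \sum_(s in A) g u * f (u * s)%g.
Proof.
move=> /convolution_bound.
under [X in 2 * X]eq_bigr do rewrite -mulr_sumr.
set h := fun u => \sum_(s in A) f (u * s)%g.
move=> Hh.
(* The weights involve [1 / nu]; for [nu = 0] the bound forces [h] to vanish instead. *)
have [nu0|nu_neq0] := eqVneq nu 0.
  have h0 : \sum_u h u ^+ 2 = 0.
    apply/eqP; rewrite eq_le sumr_ge0 ?andbT => [|u _]; last exact: sqr_ge0.
    by rewrite (le_trans Hh) // nu0 expr0n /= mul0r.
  rewrite nu0 mul0r oppr0 big1 ?mulr0 // => u _.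
  have /eqP := psumr_eq0P (fun u _ => sqr_ge0 (h u)) h0 (i := u) isT.
  by rewrite sqrf_eq0 => /eqP hu; rewrite -/(h u) hu mulr0.
have nu_gt0 : 0 < nu by rewrite lt0r nu_neq0.
have Hgh u : - (nu * g u ^+ 2) - nu^-1 * h u ^+ 2 <= 2 * (g u * h u).
  rewrite -subr_ge0.
  have -> : 2 * (g u * h u) - (- (nu * g u ^+ 2) - nu^-1 * h u ^+ 2) =
            nu * (g u + nu^-1 * h u) ^+ 2 by field.
  by rewrite mulr_ge0 ?sqr_ge0.
rewrite mulr_sumr; apply: le_trans (ler_sum _ (fun u _ => Hgh u)).
rewrite sumrB sumrN -!mulr_sumr mulrDr opprD addrC lerD2l lerN2.
by rewrite mulrC ler_pdivrMr // mulrAC -expr2.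
Qed.

(* Replacing [f] by [f - m] with [m] its mean leaves the remainder
   [(1 - t) (F - H)^2 + t (F^2 + H^2)], where [t = #|A| / #|gT|] lies in [0, 1]. *)
Lemma convolution_form_gap (f g : gT -> R) :
  - (nu * (\sum_u f u ^+ 2 + \sum_u g u ^+ 2)) <=
  2 * (\sum_u \sum_(s in A) g u * f (u * s)%g - (\sum_u f u) * (\sum_u g u))
  + (\sum_u f u) ^+ 2 + (\sum_u g u) ^+ 2.
Proof.
set F := \sum_u f u; set H := \sum_u g u.
have N_gt0 : 0 < #|gT|%:R :> R by rewrite ltr0n; apply/card_gt0P; exists 1%g.
pose m := F / #|gT|%:R.
have Fm : F = #|gT|%:R * m by rewrite mulrC divfK ?gt_eqF.
have := @convolution_form_bound (fun u => f u - m) g.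
have -> : \sum_u (f u - m) = 0.
  by rewrite sumrB sumr_const -mulr_natl -/F Fm subrr.
have -> : \sum_u (f u - m) ^+ 2 = \sum_u f u ^+ 2 - #|gT|%:R * m ^+ 2.
  under eq_bigr do rewrite sqrrB.
  rewrite big_split sumrB /= sumrMnl -mulr_suml -/F sumr_const Fm.
  by rewrite -[m ^+ 2 *+ _]mulr_natl; ring.
have -> : \sum_u \sum_(s in A) g u * (f (u * s)%g - m) =
    \sum_u \sum_(s in A) g u * f (u * s)%g - #|A|%:R * m * H.
  rewrite /H mulr_sumr -sumrB; apply: eq_bigr => u _.
  under eq_bigr do rewrite mulrBr.
  by rewrite sumrB sumr_const -mulr_natl; ring.
set B := \sum_u _; set f2 := \sum_u f u ^+ 2; set g2 := \sum_u _ ^+ 2 => HB.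
(* Centering [f] lowers its square norm by [#|gT| * m ^+ 2]; this gain is discarded. *)
have m2 : 0 <= nu * (#|gT|%:R * m ^+ 2)
  by apply: mulr_ge0 => //; apply: mulr_ge0; rewrite ?sqr_ge0 ?ler0n.
pose t := #|A|%:R / #|gT|%:R : R.
have t01 : 0 <= t <= 1.
  by rewrite divr_ge0 ?ler0n //= ler_pdivrMr // mul1r ler_nat max_card.
have Am : #|A|%:R * m = t * F by rewrite /t /m; ring.
clearbody t.
have : 0 <= (1 - t) * (F - H) ^+ 2 + t * (F ^+ 2 + H ^+ 2).
  case/andP: t01 => t0 t1.
  by rewrite addr_ge0 // mulr_ge0 ?subr_ge0 ?addr_ge0 ?sqr_ge0.
move: (HB erefl); rewrite Am => {}HB Hq; lra.
Qed.

(** The bijective substitutions [y = a^-1 u^-1 b^-1] and [z = u s c^-1] turn [a y b z c] into [s]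
    and preserve the sums of [f], [g] and their squares. *)
Lemma slice_gap (a b c : gT) (f g : gT -> R) :
  - (nu * (\sum_u f u ^+ 2 + \sum_u g u ^+ 2)) <=
  2 * (\sum_y \sum_z ((a * y * b * z * c)%g \in A)%:R * (g y * f z)
       - (\sum_u f u) * (\sum_u g u))
  + (\sum_u f u) ^+ 2 + (\sum_u g u) ^+ 2.
Proof.
have bijf : bijective (fun w : gT => w * c^-1)%g.
  by exists (fun z => z * c)%g => w; rewrite ?mulgKV ?mulgK.
have bijg : bijective (fun u : gT => a^-1 * u^-1 * b^-1)%g.
  exists (fun y => (a * y * b)^-1)%g => w; first by rewrite !mulgA mulgV mul1g mulgKV invgK.
  by rewrite invgK !mulgA mulVg mul1g mulgK.
have := convolution_form_gap (fun w => f (w * c^-1)%g)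
                             (fun u => g (a^-1 * u^-1 * b^-1)%g).
have rf (h : gT -> R) : \sum_w h (w * c^-1)%g = \sum_z h z.
  by rewrite [RHS](reindex _ (onW_bij _ bijf)).
have rg (h : gT -> R) : \sum_w h (a^-1 * w^-1 * b^-1)%g = \sum_z h z.
  by rewrite [RHS](reindex _ (onW_bij _ bijg)).
rewrite (rf f) (rf (fun z => f z ^+ 2)) (rg g) (rg (fun z => g z ^+ 2)).
rewrite [X in 2 * (X - _)](_ : _ =
  \sum_y \sum_z ((a * y * b * z * c)%g \in A)%:R * (g y * f z)) //.
rewrite -[RHS]rg; apply: eq_bigr => u _.
rewrite big_mkcond -[RHS]rf [RHS](reindex_inj (mulgI u)) /=; apply: eq_bigr => s _.
have -> : (a * (a^-1 * u^-1 * b^-1) * b * (u * s * c^-1) * c)%g = s.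
  by rewrite !mulgA mulgV mul1g !mulgKV mulVg mul1g.
by case: (s \in A); rewrite ?mul1r ?mul0r.
Qed.

End UnitaryRepresentations.

(** * Points of [G^n] and the change of one coordinate *)

Section Points.
Variables (gT : finGroupType) (n : nat).
Local Notation point := {ffun 'I_n -> gT}.
Implicit Types (x : point) (i j : 'I_n).

Definition upd x i (y : gT) : point := [ffun l => if l == i then y else x l].

Lemma updK x i y : upd (upd x i y) i (x i) = x.
Proof. by apply/ffunP => l; rewrite !ffunE; case: eqVneq => // ->. Qed.

Lemma upd_same x i y z : upd (upd x i y) i z = upd x i z.
Proof. by apply/ffunP => l; rewrite !ffunE; case: eqVneq. Qed.

Lemma updC x i j y z : i != j -> upd (upd x i y) j z = upd (upd x j z) i y.
Proof.
move=> ij; apply/ffunP => l; rewrite !ffunE.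
by case: (eqVneq l j) => // ->; rewrite eq_sym (negPf ij).
Qed.

(* [(x, y) |-> (upd x i y, x i)] is an involution. *)
Lemma sum_upd (R : pzRingType) i (F : point -> R) :
  \sum_x \sum_y F (upd x i y) = #|gT|%:R * \sum_x F x.
Proof.
pose sw (p : point * gT) := (upd p.1 i p.2, p.1 i).
have swK : involutive sw.
  by case=> x y; rewrite /sw /= updK ffunE eqxx.
rewrite pair_big /= (reindex_inj (inv_inj swK)) /= mulr_sumr.
rewrite -(pair_big xpredT xpredT (fun x y => F (upd (upd x i y) i (x i)))) /=.
by apply: eq_bigr => x _; under eq_bigr do rewrite updK; rewrite sumr_const mulr_natl.
Qed.

(* The order of the two factors depends on whether [i < j]. *)
Lemma prod_upd2 x i j : i != j -> exists a b c : gT,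
  (forall y z, \prod_(l < n) upd (upd x i y) j z l = a * y * b * z * c)%g \/
  (forall y z, \prod_(l < n) upd (upd x i y) j z l = a * z * b * y * c)%g.
Proof.
move=> ij; have := index_enum_uniq 'I_n.
have out (r : seq 'I_n) y z : i \notin r -> j \notin r ->
    (\prod_(l <- r) upd (upd x i y) j z l = \prod_(l <- r) x l)%g.
  move=> ir jr; apply: eq_big_seq => l lr; rewrite !ffunE.
  by rewrite (negPf (memPn jr _ lr)) (negPf (memPn ir _ lr)).
have vi y z : upd (upd x i y) j z i = y by rewrite !ffunE eqxx (negPf ij).
have vj y z : upd (upd x i y) j z j = z by rewrite !ffunE eqxx.
have := mem_index_enum i; have := mem_index_enum j.
case/splitPr => p q; rewrite mem_cat inE (negPf ij) /=.
rewrite cat_uniq /= negb_or => ipq /and4P[Up /andP[jp /hasPn pq] jq Uq].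
case/orP: ipq => [ip|iq].
- have iq : i \notin q by apply: contraL ip; apply: pq.
  case/splitPr: ip Up jp {pq} => p1 p2; rewrite cat_uniq /= !negb_or mem_cat inE !negb_or.
  move=> /and4P[_ /andP[ip1 _] ip2 _] /and3P[jp1 _ jp2].
  exists (\prod_(l <- p1) x l)%g, (\prod_(l <- p2) x l)%g, (\prod_(l <- q) x l)%g.
  left=> y z; rewrite big_cat big_cons big_cat big_cons /= vi vj !out //.
  by rewrite !mulgA.
- have ip : i \notin p by apply: pq.
  case/splitPr: iq Uq jq {pq} => q1 q2; rewrite cat_uniq /= !negb_or mem_cat inE !negb_or.
  move=> /and4P[_ /andP[iq1 _] iq2 _] /and3P[jq1 _ jq2].
  exists (\prod_(l <- p) x l)%g, (\prod_(l <- q1) x l)%g, (\prod_(l <- q2) x l)%g.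
  right=> y z; rewrite big_cat big_cons big_cat big_cons /= vi vj !out //.
  by rewrite !mulgA.
Qed.
End Points.

(** * Lower bound for the energy of the Laplacian, in terms of functions on points *)

Section Energy.
Variables (R : rcfType) (gT : finGroupType) (k : nat) (A : {set gT}) (nu : R).
Hypothesis nu_ge0 : 0 <= nu.
Hypothesis nu_bound :
  forall d (rG : mx_representation (R[i])%C [set: gT]%G d),
  nontriv_irr_unitary rG -> opnorm_le (fourier_ind rG A) nu.

Local Notation point := {ffun 'I_k.+1 -> gT}.
Local Notation N := (#|gT|%:R : R).
Variable Phi : 'I_k.+1 -> point -> R.
Hypothesis Phi_upd : forall i x y, Phi i (upd x i y) = Phi i x.

Definition inA (x : point) : R := ((\prod_(l < k.+1) x l)%g \in A)%:R.
Definition esgn (i j : 'I_k.+1) : R := (-1) ^+ (i + j).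

(* The value of the Laplacian of [phi] at the facet of [x] missing the vertex [i], with
   [Phi l z] the value of [phi] at the facet of [z] missing the vertex [l]. *)
Definition lap_term i x : R :=
  \sum_(j | j != i) (\sum_y Phi i (upd x j y) - esgn i j * \sum_y Phi j (upd x i y))
  + \sum_y inA (upd x i y) * \sum_j esgn i j * Phi j (upd x i y).

(** Coordinate [i] is free, so each facet missing vertex [i] is counted [#|gT|] times. *)
Definition mass i : R := \sum_x Phi i x ^+ 2.
(** Share of the pair [i], [j] in the energy: the sum with [inA] is the off-diagonal part of
    [d^* d], the other two come from [d d^*]. The factor [N] arises from summing over the free
    coordinate [i]. *)
Definition cross i j : R :=
  \sum_x Phi i x * (\sum_y Phi i (upd x j y))
  + esgn i j * (N * (\sum_x inA x * (Phi i x * Phi j x) - \sum_x Phi i x * Phi j x)).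

Lemma esgnC i j : esgn i j = esgn j i.
Proof. by rewrite /esgn addnC. Qed.

Lemma esgn_sqr i j : esgn i j ^+ 2 = 1.
Proof. exact: sqrr_sign. Qed.

(** The product has the form [p * y * q], a bijection in [y]. Thus each (k-1)-simplex lies in
    exactly [#|A|] of the k-simplices. *)
Lemma sum_inA_upd x i : \sum_y inA (upd x i y) = #|A|%:R.
Proof.
have [p [q pq]] : exists p q : gT, forall y, (\prod_(l < k.+1) upd x i y l = p * y * q)%g.
  have := index_enum_uniq 'I_k.+1; have := mem_index_enum i.
  case/splitPr => r s; rewrite cat_uniq /= negb_or => /and4P[_ /andP[ir _] i_s _].
  exists (\prod_(l <- r) x l)%g, (\prod_(l <- s) x l)%g => y.
  rewrite big_cat big_cons /= ffunE eqxx mulgA; congr (_ * _ * _)%g.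
    by apply: eq_big_seq => l lr; rewrite ffunE (negPf (memPn ir _ lr)).
  by apply: eq_big_seq => l ls; rewrite ffunE (negPf (memPn i_s _ ls)).
have bij : bijective (fun u : gT => p^-1 * u * q^-1)%g.
  exists (fun y => p * y * q)%g => w; first by rewrite !mulgA mulgV mul1g mulgKV.
  by rewrite !mulgA mulVg mul1g mulgK.
rewrite (reindex _ (onW_bij _ bij)) /= -sum1_card natr_sum [RHS]big_mkcond /=.
apply: eq_bigr => u _; rewrite /inA pq !mulgA mulgV mul1g mulgKV.
by case: (u \in A).
Qed.

Lemma sum_lap_term i :
  \sum_x Phi i x * lap_term i x = \sum_(j | j != i) cross i j + #|A|%:R * mass i.
Proof.
have avg (F : point -> R) : \sum_x Phi i x * (\sum_y F (upd x i y)) =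
    N * \sum_x Phi i x * F x.
  rewrite -(sum_upd i); apply: eq_bigr => x _; rewrite mulr_sumr.
  by apply: eq_bigr => y _; rewrite Phi_upd.
under eq_bigr do rewrite /lap_term mulrDr.
rewrite big_split /=.
rewrite (avg (fun x => inA x * \sum_j esgn i j * Phi j x)).
have -> : \sum_x Phi i x * (inA x * \sum_j esgn i j * Phi j x) =
    \sum_j esgn i j * \sum_x inA x * (Phi i x * Phi j x).
  under eq_bigr do rewrite !mulr_sumr.
  rewrite exchange_big; apply: eq_bigr => j _; rewrite mulr_sumr.
  by apply: eq_bigr => x _; ring.
have -> : \sum_x Phi i x * (\sum_(j | j != i)
      (\sum_y Phi i (upd x j y) - esgn i j * \sum_y Phi j (upd x i y))) =
    \sum_(j | j != i) (\sum_x Phi i x * (\sum_y Phi i (upd x j y))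
      - esgn i j * (N * \sum_x Phi i x * Phi j x)).
  under eq_bigr do rewrite mulr_sumr.
  rewrite exchange_big; apply: eq_bigr => j _; rewrite -avg mulr_sumr -sumrB.
  by apply: eq_bigr => x _; ring.
(* The term [j = i] is the diagonal of [d^* d]; its sign is 1 and it produces [#|A| * mass i]. *)
rewrite [X in _ * X](bigD1 i) //= mulrDr addrCA addrC; congr (_ + _).
  rewrite mulr_sumr -big_split; apply: eq_bigr => j _ /=.
  by rewrite /cross; ring.
rewrite /esgn addnn -mul2n exprM sqrrN expr1n expr1n mul1r.
under eq_bigr => x _ do rewrite -expr2.
rewrite /mass mulr_sumr -(sum_upd i); apply: eq_bigr => x _.
rewrite -(sum_inA_upd x i) mulr_suml; apply: eq_bigr => y _.
by rewrite Phi_upd.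
Qed.

(** Apply [slice_gap] with all coordinates but [i] and [j] frozen at [x], then sum over [x]. Both
    sides come out multiplied by [N]: the squared slice sums give the first terms of [cross]. *)
Lemma cross_lower i j : i != j ->
  - (nu * (mass i + mass j)) <= cross i j + cross j i.
Proof.
move=> ij.
have N_gt0 : 0 < N by rewrite ltr0n; apply/card_gt0P; exists 1%g.
have slice x :
  - (nu * (\sum_z Phi i (upd x j z) ^+ 2 + \sum_y Phi j (upd x i y) ^+ 2)) <=
  2 * esgn i j * (\sum_y \sum_z (inA (upd (upd x i y) j z) - 1) *
             (Phi i (upd x j z) * Phi j (upd x i y)))
  + (\sum_z Phi i (upd x j z)) ^+ 2 + (\sum_y Phi j (upd x i y)) ^+ 2.
  (* The sign goes into [g] and disappears from its squares. The [- 1] beside [inA], coming from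
     [d d^*], becomes the product of the two sums. *)
  pose f z := Phi i (upd x j z); pose g y := esgn i j * Phi j (upd x i y).
  have -> : \sum_y Phi j (upd x i y) ^+ 2 = \sum_y g y ^+ 2.
    by apply: eq_bigr => y _; rewrite exprMn esgn_sqr mul1r.
  have -> : (\sum_y Phi j (upd x i y)) ^+ 2 = (\sum_y g y) ^+ 2.
    by rewrite -mulr_sumr exprMn esgn_sqr mul1r.
  have -> : 2 * esgn i j * (\sum_y \sum_z (inA (upd (upd x i y) j z) - 1) *
             (Phi i (upd x j z) * Phi j (upd x i y))) =
    2 * (\sum_y \sum_z inA (upd (upd x i y) j z) * (g y * f z)
         - (\sum_z f z) * (\sum_y g y)).
    rewrite -mulrA; congr (_ * _).
    rewrite [LHS]mulr_sumr [X in _ - X]mulrC [X in _ - X]mulr_suml -sumrB.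
    apply: eq_bigr => y _; rewrite !mulr_sumr -sumrB.
    by apply: eq_bigr => z _; rewrite /g /f; ring.
  rewrite /inA; have [a [b [c [E|E]]]] := prod_upd2 x ij.
    under [X in 2 * (X - _)]eq_bigr do under eq_bigr do rewrite E.
    exact: (slice_gap nu_ge0 nu_bound a b c f g).
  (* Here coordinate [j] precedes [i] in the product, so [f] and [g] exchange roles. *)
  under [X in 2 * (X - _)]eq_bigr do under eq_bigr do rewrite E.
  have := slice_gap nu_ge0 nu_bound a b c g f.
  rewrite exchange_big /= -/f -/g.
  have -> : \sum_z \sum_y ((a * y * b * z * c)%g \in A)%:R * (f y * g z) =
     \sum_z \sum_y ((a * y * b * z * c)%g \in A)%:R * (g z * f y).
    by apply: eq_bigr => z _; apply: eq_bigr => y _; rewrite [f y * _]mulrC.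
  move=> H; lra.
have avg2 (F : point -> R) : \sum_x \sum_y \sum_z F (upd (upd x i y) j z) = N * (N * \sum_x F x).
  by rewrite (sum_upd i (fun x => \sum_z F (upd x j z))) sum_upd.
have sq l m : \sum_x (\sum_z Phi l (upd x m z)) ^+ 2 =
    N * \sum_x Phi l x * \sum_y Phi l (upd x m y).
  rewrite -(sum_upd m); apply: eq_bigr => x _; rewrite expr2 mulr_suml.
  apply: eq_bigr => z _; congr (_ * _); apply: eq_bigr => y _.
  by rewrite upd_same.
have : \sum_x - (nu * (\sum_z Phi i (upd x j z) ^+ 2 + \sum_y Phi j (upd x i y) ^+ 2))
   <= _ := ler_sum _ (fun x _ => slice x).
rewrite sumrN -mulr_sumr big_split /=.
rewrite (sum_upd j (fun x => Phi i x ^+ 2)) (sum_upd i (fun x => Phi j x ^+ 2)).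
rewrite !big_split /= !sq -mulr_sumr.
have -> : \sum_x \sum_y \sum_z (inA (upd (upd x i y) j z) - 1) *
             (Phi i (upd x j z) * Phi j (upd x i y)) =
   N * (N * (\sum_x inA x * (Phi i x * Phi j x) - \sum_x Phi i x * Phi j x)).
  rewrite -sumrB -avg2; apply: eq_bigr => x _; apply: eq_bigr => y _.
  apply: eq_bigr => z _; rewrite Phi_upd [upd (upd x i y) j z]updC // Phi_upd.
  by ring.
rewrite /cross -!/(mass _) [esgn j i]esgnC.
have -> : \sum_x inA x * (Phi j x * Phi i x) = \sum_x inA x * (Phi i x * Phi j x).
  by apply: eq_bigr => x _; ring.
have -> : \sum_x Phi j x * Phi i x = \sum_x Phi i x * Phi j x.
  by apply: eq_bigr => x _; ring.
move=> H; rewrite -(ler_pM2l N_gt0); lra.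
Qed.

(** Summing [cross_lower] over ordered pairs counts each [cross] twice and each [mass i] in [2 k]
    places; halving leaves [k * nu]. *)
Lemma energy_lower :
  (#|A|%:R - k%:R * nu) * \sum_i mass i <=
  \sum_i \sum_x Phi i x * lap_term i x.
Proof.
under [X in _ <= X]eq_bigr do rewrite sum_lap_term.
rewrite big_split /= -mulr_sumr.
have cnt (i : 'I_k.+1) (c : R) : \sum_(j | j != i) c = k%:R * c.
  by rewrite sumr_const cardC1 card_ord mulr_natl.
have sym (F : 'I_k.+1 -> 'I_k.+1 -> R) :
    \sum_i \sum_(j | j != i) F i j = \sum_i \sum_(j | j != i) F j i.
  rewrite (exchange_big_dep xpredT) //=; apply: eq_bigr => i _.
  by apply: eq_bigl => j; rewrite eq_sym.
have : \sum_i \sum_(j | j != i) - (nu * (mass i + mass j)) <=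
       \sum_i \sum_(j | j != i) (cross i j + cross j i).
  apply: ler_sum => i _; apply: ler_sum => j ji; apply: cross_lower.
  by rewrite eq_sym.
have -> : \sum_i \sum_(j | j != i) (cross i j + cross j i) =
    2 * \sum_i \sum_(j | j != i) cross i j.
  under eq_bigr do rewrite big_split.
  by rewrite big_split /= -(sym cross); ring.
have -> : \sum_i \sum_(j | j != i) - (nu * (mass i + mass j)) =
    - (2 * (k%:R * nu * \sum_i mass i)).
  transitivity (- \sum_i \sum_(j | j != i) (nu * mass i) - \sum_i \sum_(j | j != i) (nu * mass j)).
    rewrite -opprD -big_split -sumrN; apply: eq_bigr => i _.
    by rewrite -big_split -sumrN; apply: eq_bigr => j _ /=; rewrite mulrDr.
  rewrite -(sym (fun i _ => nu * mass i)); under eq_bigr do rewrite cnt.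
  by rewrite -!mulr_sumr; ring.
move=> H; lra.
Qed.

End Energy.

(** * Facets, ridges and their orientation signs *)

Section Faces.
Variables (gT : finGroupType) (n : nat).
Local Notation point := {ffun 'I_n -> gT}.
Implicit Types (x : point) (i j : 'I_n).

Definition full x : simplex gT n := [ffun l => Some (x l)].
Definition facet x i : simplex gT n := rem_vertex (full x) i.

Lemma supp_full x : supp (full x) = setT.
Proof. by apply/setP => l; rewrite !inE ffunE. Qed.

Lemma supp_rem (s : simplex gT n) i : supp (rem_vertex s i) = supp s :\ i.
Proof. by apply/setP => l; rewrite !inE ffunE; case: (l == i). Qed.

Lemma facet_upd x i y : facet (upd x i y) i = facet x i.
Proof. by apply/ffunP => l; rewrite !ffunE; case: eqVneq. Qed.

Lemma add_facet x i y : add_vertex (facet x i) i y = full (upd x i y).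
Proof. by apply/ffunP => l; rewrite !ffunE; case: eqVneq. Qed.

Lemma add_ridge x i j y : j != i ->
  add_vertex (rem_vertex (facet x i) j) i y = facet (upd x i y) j.
Proof.
move=> ji; apply/ffunP => l; rewrite !ffunE.
by case: (eqVneq l i) => // ->; rewrite eq_sym (negPf ji).
Qed.

Lemma rem_facetC x i j : rem_vertex (facet x i) j = rem_vertex (facet x j) i.
Proof. by apply/ffunP => l; rewrite !ffunE; case: eqVneq; case: eqVneq. Qed.

(** The additive form avoids truncated subtraction. *)
Lemma pos_rem (s : simplex gT n) i j :
  (pos (rem_vertex s i) j + ((i \in supp s) && (i < j)) = pos s j)%N.
Proof.
rewrite /pos supp_rem [RHS](cardsD1 i) !inE addnC; congr (_ + _)%N.
by apply: eq_card => l; rewrite !inE andbA.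
Qed.

Lemma pos_full x i : pos (full x) i = i.
Proof.
rewrite /pos supp_full -[RHS](card_ord i) -sum1_card -[RHS]sum1_card.
rewrite (big_ord_widen n (fun=> 1%N)) ?(ltnW (ltn_ord i)) //.
by apply: eq_bigl => l; rewrite !inE.
Qed.

(** The two positions are [j] and [i], except that the larger index drops by one because the smaller
    one is missing; hence the extra minus sign. *)
Lemma sgn_ridge (R : pzRingType) x i j : j != i ->
  sgn R (pos (facet x i) j) * sgn R (pos (rem_vertex (facet x i) j) i) =
  - (-1) ^+ (i + j).
Proof.
move=> ji; rewrite /sgn -exprD.
have := pos_rem (facet x i) j i; have := pos_rem (full x) i j.
have := pos_rem (full x) i i.
rewrite -/(facet x i) !pos_full supp_rem supp_full !inE ji ltnn /= addn0 => ->.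
have : (nat_of_ord j != i) by [].
case: (ltngtP i j) => // _ _ <- <-; rewrite ?addn0 ?addn1.
  by rewrite addnS exprS mulN1r opprK addnC.
by rewrite addSn exprS mulN1r opprK addnC.
Qed.

End Faces.

(** * The Laplacian of [Y_A] in coordinates *)

Section Laplacian.
Variables (R : rcfType) (gT : finGroupType) (k : nat) (A : {set gT}).
Local Notation point := {ffun 'I_k.+1 -> gT}.
Implicit Types (x : point) (i j : 'I_k.+1).

Lemma card_supp_facet x i : #|supp (facet x i)| = k.
Proof.
by rewrite supp_rem supp_full setTD cardsC1 card_ord.
Qed.

Lemma Y_A_facet x i : Y_A A (facet x i).
Proof. by rewrite /Y_A /= card_supp_facet leqnn. Qed.

Lemma Y_A_full x : Y_A A (full x) = ((\prod_(l < k.+1) x l)%g \in A).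
Proof.
rewrite /Y_A /= supp_full cardsT card_ord ltnn eqxx /=.
by congr (_ \in A); apply: eq_bigr => l _; rewrite ffunE.
Qed.

Lemma laplacian_facet (phi : simplex gT k.+1 -> R) x i :
  laplacian (Y_A A) phi (facet x i) =
  lap_term A (fun l (z : point) => phi (facet z l)) i x.
Proof.
rewrite /laplacian /lap_term; congr (_ + _).
- rewrite /cobd; apply: eq_big => [j|j]; first by rewrite supp_rem supp_full !inE andbT.
  rewrite supp_rem supp_full !inE andbT => ji.
  (* The ridge misses only [i] and [j]. Refilling [j] squares a sign, refilling [i] gives
     [sgn_ridge]; all these facets lie in the full skeleton. *)
  rewrite /cobd_adj (bigD1 j) /=; last by rewrite !(supp_rem, inE) eqxx.
  rewrite (big_pred1 i) => [|l]; last first.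
    rewrite /= 2!supp_rem supp_full !inE andbT negb_and !negbK.
    by case: (eqVneq l j) => [->|]; rewrite /= ?andbT // (negPf ji).
  have posj : pos (rem_vertex (facet x i) j) j = pos (facet x i) j.
    by rewrite -[RHS](pos_rem _ j j) ltnn andbF addn0.
  have -> : \sum_y (if Y_A A (add_vertex (rem_vertex (facet x i) j) j y) then
      sgn R (pos (rem_vertex (facet x i) j) j) *
      phi (add_vertex (rem_vertex (facet x i) j) j y) else 0) =
      sgn R (pos (facet x i) j) * \sum_y phi (facet (upd x j y) i).
    rewrite mulr_sumr; apply: eq_bigr => y _; rewrite posj.
    by rewrite rem_facetC add_ridge 1?eq_sym // Y_A_facet.
  have -> : \sum_y (if Y_A A (add_vertex (rem_vertex (facet x i) j) i y) then
      sgn R (pos (rem_vertex (facet x i) j) i) *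
      phi (add_vertex (rem_vertex (facet x i) j) i y) else 0) =
      sgn R (pos (rem_vertex (facet x i) j) i) * \sum_y phi (facet (upd x i y) j).
    rewrite mulr_sumr; apply: eq_bigr => y _.
    by rewrite add_ridge // Y_A_facet.
  by rewrite mulrDr !mulrA sgn_ridge // mulNr /sgn -expr2 sqrr_sign mul1r.
(* Only vertex [i] can be added, and membership of the resulting full simplex in [Y_A] becomes the
   factor [inA]. *)
- rewrite /cobd_adj (big_pred1 i) => [|l]; last first.
    by rewrite /= supp_rem supp_full !inE andbT negbK.
  apply: eq_bigr => y _; rewrite add_facet Y_A_full /inA.
  case: ifP => _; rewrite ?mul0r // mul1r /cobd supp_full mulr_sumr.
  apply: eq_big => [j|j _]; first by rewrite inE.
  have -> : pos (facet x i) i = i.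
    by have := pos_rem (full x) i i; rewrite ltnn andbF addn0 pos_full.
  by rewrite mulrA pos_full /sgn /esgn exprD.
Qed.

Lemma facetP (t : simplex gT k.+1) :
  faces_of (Y_A A) k t -> exists x i, t = facet x i.
Proof.
case/andP=> _ /eqP ct.
have /cards1P[i ti] : #|~: supp t| == 1%N.
  by rewrite cardsCs setCK card_ord ct subSnn.
(* The default value at the missing coordinate [i] is erased by [facet]. *)
exists [ffun l => odflt 1%g (t l)], i; apply/ffunP => l; rewrite !ffunE.
have /setP/(_ l) := ti; rewrite !inE negbK => <-.
by case: (t l).
Qed.

End Laplacian.

Theorem theorem1p3 (R : rcfType) (gT : finGroupType) (k : nat) (A : {set gT})
  (nu mu : R) :
  (0 < k)%N -> A != set0 ->
  is_nu A nu ->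
  is_spectral_gap (@Y_A gT k A) k mu ->
  #|A|%:R - k%:R * nu <= mu.
Proof.
move=> _ _ [nu_ge0 nu_bound _] [[phi [[t [tF phit]] eig]] _].
pose Phi (i : 'I_k.+1) (x : {ffun 'I_k.+1 -> gT}) := phi (facet x i).
have Phi_upd i x y : Phi i (upd x i y) = Phi i x by rewrite /Phi facet_upd.
have := energy_lower nu_ge0 nu_bound Phi_upd.
have -> : \sum_i \sum_x Phi i x * lap_term A Phi i x = mu * \sum_i mass Phi i.
  rewrite mulr_sumr; apply: eq_bigr => i _; rewrite mulr_sumr.
  apply: eq_bigr => x _; rewrite -laplacian_facet eig.
    by rewrite /Phi; ring.
  by rewrite /faces_of inE Y_A_facet card_supp_facet eqxx.
(* The total mass cancels once it is positive: the simplex [t] with [phi t != 0] is some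
   [facet x i], giving a positive term in [mass Phi i]. *)
rewrite ler_pM2r //.
have [x [i tE]] := facetP tF.
have mass_ge0 j : 0 <= mass Phi j by apply: sumr_ge0 => z _; apply: sqr_ge0.
rewrite (bigD1 i) //= ltr_wpDr ?sumr_ge0 //.
rewrite /mass (bigD1 x) //= ltr_wpDr ?sumr_ge0 // => [z _|]; first exact: sqr_ge0.
by rewrite lt0r sqr_ge0 andbT sqrf_eq0 /Phi -tE.
Qed.
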